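(* Let $N\ge2$, let $\mathbf{z}=(z_1>\cdots>z_N)$, and let $\mathsf{a}=(\mathsf{a}_1,\ldots,\mathsf{a}_N)\in\mathbb{R}^N$. For every point $\mathbf{Y}$ of the open Gelfand--Tsetlin polytope with top row $\mathbf{z}$, the quadratic form $$Q_{\mathbf{Y}}(\mathbf{v})=\sum_{k=1}^{N-1}\Bigl[\sum_{1\le i<j\le k}\frac{(v_i^k-v_j^k)^2}{2(y_i^k-y_j^k)^2}-\sum_{p=1}^k\sum_{q=1}^{k+1}\frac{(v_p^k-v_q^{k+1})^2}{4(y_p^k-y_q^{k+1})^2}\Bigr],$$ acting on real fields $\mathbf{v}=\{v_i^k\}_{1\le i\le k\le N}$ with $v_i^N=0$ for all $i$, is negative definite. Consequently, the effective Hamiltonian $H_{\mathsf{a}}$ is strictly convex on the (open) Gelfand--Tsetlin polytope.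
   Context: The open Gelfand--Tsetlin polytope with top row $\mathbf{z}$ is the set of arrays $\mathbf{Y}=(\mathbf{y}^1,\ldots,\mathbf{y}^{N-1})$, $\mathbf{y}^k=(y_1^k,\ldots,y_k^k)\in\mathbb{R}^k$, such that with $\mathbf{y}^N=\mathbf{z}$ one has strict interlacing $y_1^{k+1}>y_1^k>y_2^{k+1}>\cdots>y_k^k>y_{k+1}^{k+1}$ for all $k=1,\ldots,N-1$. The effective Hamiltonian is $$H_{\mathsf{a}}(\mathbf{Y})=\sum_{k=1}^{N-1}\Bigl[\sum_{1\le i<j\le k}\log(y_i^k-y_j^k)-\frac12\sum_{p=1}^k\sum_{q=1}^{k+1}\log|y_p^k-y_q^{k+1}|-\frac{\mathsf{a}_k-\mathsf{a}_{k+1}}{2}\sum_{i=1}^k y_i^k\Bigr],\qquad \mathbf{y}^N=\mathbf{z}.$$ The form $Q_{\mathbf{Y}}$ equals $-\frac12$ times the Hessian quadratic form of $H_{\mathsf{a}}$ at $\mathbf{Y}$. *)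

(* Defs.v *)
From HB Require Import structures.
From mathcomp Require Import all_boot all_order all_algebra.
From mathcomp Require Import all_classical all_reals all_analysis.

Set Implicit Arguments.
Unset Strict Implicit.
Unset Printing Implicit Defensive.

Import Order.TTheory GRing.Theory Num.Theory.
Import numFieldNormedType.Exports.

Local Open Scope classical_set_scope.
Local Open Scope ring_scope.
Local Open Scope convex_scope.

(* The strict counterpart of [convex_function]; unlike there, convexity of the
   domain [D] is part of the definition. *)
Definition strictly_convex_function (R : numFieldType) (E : lmodType R)
    (E' := convex_lmodType E) (D : set E') (f : E' -> R^o) : Prop :=
  convex_set D /\
  forall t : {i01 R}, 0 < t%:num < 1 ->
    {in D &, forall x y : E', x != y ->
      (f (x <| t |> y) < f x <| t |> f y)%R}.

(* Real triangular arrays (x_i^k) with 1 <= i <= k <= n, indexed by the pairs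
   (k, i).  The form {ffun _ -> R^o} carries the pointwise lmodType
   structure. *)
Notation tri_index n := {p : 'I_n.+1 * 'I_n.+1 | (1 <= p.2 <= p.1)%N}.
Notation tri_array R n := {ffun tri_index n -> R^o}.

Section GelfandTsetlin.
Variable R : realType.

(* [entry x k i] is x_i^k, with k and i counted from 1; the value is 0 outside
   1 <= i <= k <= n (inord sends an out-of-range number to 0, which is not a
   valid index). *)
Definition entry n (x : tri_array R n) (k i : nat) : R :=
  if insub (inord k, inord i) is Some p then x (p : tri_index n) else 0.

Lemma entryE n (x : tri_array R n) (p : tri_index n) :
  entry x (val p).1 (val p).2 = x p.
Proof. by rewrite /entry !inord_val -surjective_pairing valK. Qed.

Variable N : nat.
Implicit Types (a z : N.-tuple R) (Y : tri_array R N.-1) (v : tri_array R N).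

(* y_i^k for 1 <= i <= k <= N, where y^N = z; tuples being indexed from 0,
   z_i is z`_i.-1. *)
Definition gt_entry z Y (k i : nat) : R :=
  if k == N then z`_i.-1 else entry Y k i.

Definition gt_polytope z : set (tri_array R N.-1) :=
  [set Y | let y := gt_entry z Y in
    forall k i, (1 <= k < N)%N -> (1 <= i <= k)%N ->
      y k.+1 i > y k i /\ y k i > y k.+1 i.+1].

Definition eff_hamiltonian a z Y : R :=
  let y := gt_entry z Y in
  \sum_(1 <= k < N)
    (\sum_(1 <= i < k.+1) \sum_(i.+1 <= j < k.+1) ln (y k i - y k j)
     - 2^-1 * (\sum_(1 <= p < k.+1) \sum_(1 <= q < k.+2)
                 ln `|y k p - y k.+1 q|)
     - (a`_k.-1 - a`_k) / 2 * (\sum_(1 <= i < k.+1) y k i)).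

Definition gt_form z Y v : R :=
  let y := gt_entry z Y in
  \sum_(1 <= k < N)
    (\sum_(1 <= i < k.+1) \sum_(i.+1 <= j < k.+1)
       (entry v k i - entry v k j) ^+ 2 / (2 * (y k i - y k j) ^+ 2)
     - \sum_(1 <= p < k.+1) \sum_(1 <= q < k.+2)
         (entry v k p - entry v k.+1 q) ^+ 2 / (4 * (y k p - y k.+1 q) ^+ 2)).

End GelfandTsetlin.

(* Main.v *)
Require Import Defs.
From HB Require Import structures.
From mathcomp Require Import all_boot all_order all_algebra.
From mathcomp Require Import all_classical all_reals all_analysis.
From mathcomp Require Import ring lra zify.

(** For two interlacing rows x (of length k) and w (of length k + 1), the
    function

      log (prod_(i < j) (x_i - x_j) * prod_(i < j) (w_i - w_j)
           / prod_(p, q) |x_p - w_q|)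

    is the logarithm of a Cauchy determinant (bordered by a row of ones), and
    the heart of the proof is that it is convex.  In the direction (u, t) its
    second derivative is tr (M^-1 M'') - tr ((M^-1 M')^2) for the Cauchy matrix
    M.  Interlacing means that M, scaled by positive weights of rows and
    columns, is an orthogonal matrix O.  If G_pq = (u_p - t_q) / (x_p - w_q),
    the first trace is twice the squared Frobenius norm of the entrywise product
    of O and G, and the second trace is at most that squared norm.  The norm is
    therefore a lower bound for the second derivative, and it vanishes only if
    all u_p and t_q agree.  The algebraic form of this computation, which needs only the
    orthogonality relations of the Cauchy matrix, is [trace_identity]; the
    resulting inequality is [interlacing_inequality].

    Spelled out, the inequality bounds the sum of the squared divided
    differences between two adjacent rows from below by the sums of the squared
    divided differences inside each of them.  In the form Q every row sum has the
    weight 1/2, and the cross sums to the row above and to the row below, with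
    weight -1/4, compensate half of it each.  What remains after telescoping
    are boundary terms, which are zero: the first row has one entry and the
    last row of the field vanishes.  The equality case then propagates the vanishing downwards from
    the last row; this is [triangular_form_lt0].

    For the Hamiltonian, the second derivative along a segment of the polytope
    is -2 Q evaluated on the direction of the segment
    ([second_deriv01_hamiltonian]), and the mean value theorem turns its
    positivity into strict convexity. *)

Set Implicit Arguments.
Unset Strict Implicit.
Unset Printing Implicit Defensive.

Import Order.TTheory GRing.Theory Num.Theory.
Import numFieldNormedType.Exports.

Local Open Scope classical_set_scope.
Local Open Scope ring_scope.

(** * Orthogonality relations of the Cauchy matrix *)

(** Lagrange interpolation at [k + 1] nodes reproduces [g]; the sum reads off
    the coefficient of degree [k], each basis polynomial being a scalar
    multiple of a monic one. *)
Lemma sum_lagrange_weights (F : fieldType) (k : nat) (w : 'I_k.+1 -> F)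
    (g : {poly F}) :
  injective w -> (size g <= k.+1)%N ->
  \sum_q g.[w q] / \prod_(i < k) (w q - w (lift q i)) = g`_k.
Proof.
move=> w_inj sg.
pose D (q : 'I_k.+1) := \prod_(i < k) (w q - w (lift q i)).
pose ell (q : 'I_k.+1) := \prod_(i < k) ('X - (w (lift q i))%:P).
have ellE q r : (ell q).[w r] = D q * (q == r)%:R.
  rewrite /ell horner_prod; case: (eqVneq q r) => [<-|qr].
    by rewrite mulr1; apply: eq_bigr => i _; rewrite !hornerE.
  rewrite mulr0; case: (unliftP q r) qr => [i ->|->]; last by rewrite eqxx.
  by move=> _; rewrite (bigD1 i)//= !hornerE subrr mul0r.
have D0 q : D q != 0.
  apply/prodf_neq0 => i _; rewrite subr_eq0; apply/eqP => /w_inj /eqP.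
  by rewrite (negPf (neq_lift q i)).
have sell q : size (ell q) = k.+1.
  by rewrite /ell size_prod_XsubC /index_enum -enumT size_enum_ord.
have cell q : (ell q)`_k = 1.
  have := monic_prod_XsubC (index_enum 'I_k) predT (fun i => w (lift q i)).
  by rewrite monicE lead_coefE -/(ell q) sell => /eqP.
pose L := \sum_q (g.[w q] / D q) *: ell q.
suff -> : g = L.
  rewrite /L coef_sum; apply: eq_bigr => q _; rewrite coefZ cell mulr1.
  rewrite -/(D q) horner_sum (bigD1 q)//= big1 => [|r rq].
    by rewrite addr0 hornerZ ellE eqxx mulr1 divfK.
  by rewrite hornerZ ellE (negPf rq) !mulr0.
apply/eqP; rewrite -subr_eq0.
apply/eqP/(@roots_geq_poly_eq0 _ _ (map w (enum 'I_k.+1))).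
- apply/allP => _ /mapP[q _ ->]; rewrite /root hornerD hornerN horner_sum.
  rewrite (bigD1 q)//= big1 => [|r rq].
    by rewrite addr0 hornerZ ellE eqxx mulr1 divfK// subrr.
  by rewrite hornerZ ellE (negPf rq) !mulr0.
- by rewrite map_inj_uniq ?enum_uniq.
rewrite size_map size_enum_ord (leq_trans (size_polyD _ _))// geq_max sg/=.
rewrite size_polyN; apply: (leq_trans (size_sum _ _ _)).
by apply/bigmax_leqP => q _; rewrite (leq_trans (size_scale_leq _ _))// sell.
Qed.

Section CauchyOrthogonality.
Variables (F : fieldType) (k : nat) (x : 'I_k -> F) (w : 'I_k.+1 -> F).
Hypotheses (x_inj : injective x) (w_inj : injective w).
Hypothesis xw : forall p q, x p != w q.

(** The partial fraction weights of the rational function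
    prod_p (X - x_p) / prod_q (X - w_q) = sum_q residue q / (X - w_q).  The
    factors of numerator and denominator are paired by [lift q] so that, for
    interlacing nodes, each single quotient is positive. *)
Definition residue q := \prod_(p < k) ((w q - x p) / (w q - w (lift q p))).

Let C p q := (x p - w q)^-1.
Let c := residue.

Lemma residue_neq0 q : c q != 0.
Proof.
apply/prodf_neq0 => p _; rewrite mulf_neq0 ?invr_eq0 ?subr_eq0//.
  by rewrite eq_sym.
by apply/eqP => /w_inj/eqP; rewrite (negPf (neq_lift q p)).
Qed.

(** Both sums below are Lagrange sums: for the numerator, monic of degree [k],
    and for the numerator with the factor [X - x p] removed, whose coefficient
    of degree [k] vanishes. *)
Lemma sum_residue : \sum_q c q = 1.
Proof.
pose g := \prod_(p < k) ('X - (x p)%:P).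
have sg : size g = k.+1.
  by rewrite /g size_prod_XsubC /index_enum -enumT size_enum_ord.
transitivity (g`_k).
  rewrite -(sum_lagrange_weights w_inj) ?sg//; apply: eq_bigr => q _.
  rewrite /c /residue prodf_div horner_prod; congr (_ / _).
  by apply: eq_bigr => i _; rewrite !hornerE.
have := monic_prod_XsubC (index_enum 'I_k) predT x.
by rewrite monicE lead_coefE -/g sg => /eqP.
Qed.

Lemma sum_residue_pole p : \sum_q c q * C p q = 0.
Proof.
pose g := \prod_(i < k | i != p) ('X - (x i)%:P).
have sg : (size g <= k)%N.
  rewrite /g -big_filter size_prod_XsubC size_filter -/(count _ _).
  rewrite -[X in (_ < X)%N](size_enum_ord k) -(count_predC (pred1 p)).
  by rewrite /index_enum -enumT -[ltnLHS]add0n ltn_add2r -has_count has_pred1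
    mem_enum.
have := sum_lagrange_weights w_inj (leq_trans sg (leqnSn k)).
rewrite (nth_default 0 sg) => /(congr1 -%R); rewrite oppr0 -sumrN.
apply: etrans; apply: eq_bigr => q _; rewrite /c /residue prodf_div.
rewrite -mulNr mulrAC; congr (_ / _).
rewrite horner_prod (bigD1 p)//= mulrAC /C -opprB mulNr divff ?subr_eq0//.
rewrite mulN1r; congr (- _).
by apply: eq_bigr => i _; rewrite !hornerE.
Qed.

(* With these dual weights, the k rows sqrt (e p * c q) / (x p - w q) together
   with the row sqrt (c q) form an orthogonal matrix; the square roots are
   avoided by keeping the weights outside. *)
Variable e : 'I_k -> F.
Hypothesis eE : forall p, e p * (\sum_q c q * C p q ^+ 2) = 1.

Lemma inv_diff_row p p' q : p != p' ->
  C p q * C p' q = (C p' q - C p q) / (x p - x p').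
Proof.
move=> pp; have := xw p q; have := xw p' q.
have : x p != x p' by apply: contra pp => /eqP/x_inj->.
rewrite -!(subr_eq0 (x _)) /C => h1 h2 h3.
by field; rewrite h1 h2 h3.
Qed.

Lemma inv_diff_col p q q' : q != q' ->
  C p q * C p q' = (C p q - C p q') / (w q - w q').
Proof.
move=> pp; have := xw p q; have := xw p q'.
have : w q != w q' by apply: contra pp => /eqP/w_inj->.
rewrite -(subr_eq0 (w _)) -!(subr_eq0 (x _)) /C => h1 h2 h3.
by field; rewrite h1 h2 h3.
Qed.

Lemma dual_weight_neq0 p : e p != 0.
Proof.
apply/eqP => e0; move: (eE p); rewrite e0 mul0r => /eqP.
by rewrite eq_sym oner_eq0.
Qed.

Lemma row_orthogonal p p' :
  \sum_q c q * (C p q * C p' q) = (p == p')%:R / e p.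
Proof.
have e0 := dual_weight_neq0 p; case: (eqVneq p p') => [<-|pp].
  by apply: (mulfI e0); rewrite eE mul1r divff.
rewrite mul0r; under eq_bigr do rewrite inv_diff_row// mulrA mulrBr mulrBl.
by rewrite sumrB -!mulr_suml !sum_residue_pole !mul0r subrr.
Qed.

(** A square matrix with orthonormal rows has orthonormal columns; the term
    [- c q] is the contribution of the row [sqrt (c q)]. *)
Lemma col_orthogonal q q' :
  \sum_p e p * (C p q * C p q') * c q = (q == q')%:R - c q.
Proof.
pose A : 'M[F]_(1 + k, k.+1) :=
  col_mx (const_mx 1) (\matrix_(p, r) (e p * C p r)).
pose B : 'M[F]_(k.+1, 1 + k) :=
  row_mx (\col_r c r) (\matrix_(r, p) (c r * C p r)).
have AB : A *m B = 1%:M.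
  rewrite /A /B mul_col_row -[1%:M]submxK; congr block_mx;
    apply/matrixP => i j; rewrite !mxE.
  - rewrite !ord1 -[RHS]sum_residue; apply: eq_bigr => r _.
    by rewrite !mxE mul1r.
  - rewrite eq_lrshift -[RHS](sum_residue_pole j); apply: eq_bigr => r _.
    by rewrite !mxE mul1r.
  - rewrite eq_rlshift; transitivity (e i * \sum_q c q * C i q).
      rewrite mulr_sumr; apply: eq_bigr => r _; rewrite !mxE; ring.
    by rewrite sum_residue_pole mulr0.
  - rewrite (inj_eq (@rshift_inj 1 k)).
    transitivity (e i * ((i == j)%:R / e i)); last first.
      by rewrite mulrCA divff ?mulr1 ?dual_weight_neq0.
    rewrite -row_orthogonal mulr_sumr.
    by apply: eq_bigr => r _; rewrite !mxE; ring.
have := mulmx1C AB => /matrixP /(_ q q').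
rewrite mul_row_col !mxE big_ord1 !mxE mulr1 => <-.
rewrite addrAC subrr add0r; apply: eq_bigr => p _; rewrite !mxE; ring.
Qed.

Lemma sum_row_cubic p p' : p != p' ->
  \sum_q c q * (C p q * C p' q ^+ 2) = (e p' * (x p - x p'))^-1.
Proof.
move=> pp.
transitivity ((\sum_q c q * (C p' q * C p' q)
               - \sum_q c q * (C p q * C p' q)) / (x p - x p')).
  rewrite -sumrB mulr_suml; apply: eq_bigr => q _.
  by rewrite expr2 (mulrA (C p q)) [in LHS](inv_diff_row _ pp); ring.
by rewrite !row_orthogonal eqxx (negPf pp) mul0r subr0 mul1r invfM.
Qed.

Lemma sum_col_cubic q q' : q != q' ->
  \sum_p e p * (C p q * C p q' ^+ 2) = (c q' * (w q' - w q))^-1.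
Proof.
move=> qq; have w0 : w q' - w q != 0.
  by rewrite subr_eq0 eq_sym; apply: contra qq => /eqP/w_inj->.
apply: (mulIf (residue_neq0 q')); rewrite invfM mulrAC.
rewrite mulVf ?residue_neq0// mul1r.
transitivity ((\sum_p e p * (C p q * C p q') * c q' -
               \sum_p e p * (C p q' * C p q') * c q') / (w q - w q')).
  rewrite -sumrB mulr_suml mulr_suml; apply: eq_bigr => p _.
  by rewrite expr2 (mulrA (C p q)) [in LHS](inv_diff_col _ qq); ring.
have col r : \sum_p e p * (C p r * C p q') * c q' = (q' == r)%:R - c q'.
  by rewrite -col_orthogonal; apply: eq_bigr => p _; ring.
rewrite !col eqxx eq_sym (negPf qq) mulr0n mulr1n.
rewrite (_ : 0 - _ - _ = -1); last by ring.
by rewrite -[w q - _]opprB invrN mulrNN mul1r.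
Qed.

(** The factor [C p0 q0] is taken out by means of the telescoping
    x_p0 - w_q0 = (x_p0 - w_q) + (w_q - x_p) + (x_p - w_q0); each of the three
    summands cancels one denominator, so that orthogonality evaluates what
    remains. *)
Lemma sum_quartic p0 q0 :
  \sum_p \sum_q e p * c q * (C p q * C p0 q ^+ 2 * C p q0 ^+ 2) =
  2 * C p0 q0 ^+ 3 - C p0 q0 / (e p0 * c q0).
Proof.
have split_term p q : e p * c q * (C p q * C p0 q ^+ 2 * C p q0 ^+ 2) =
    C p0 q0 * (e p * C p q0 ^+ 2 * (c q * (C p0 q * C p q))
             - e p * C p q0 ^+ 2 * (c q * (C p0 q * C p0 q))
             + c q * C p0 q ^+ 2 * (e p * (C p q0 * C p q))).
  have := xw p q; have := xw p0 q; have := xw p q0; have := xw p0 q0.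
  rewrite -!(subr_eq0 (x _)) /C => h1 h2 h3 h4.
  by field; rewrite h1 h2 h3 h4.
have sq1 p : \sum_q c q * (C p0 q * C p q) = (p0 == p)%:R / e p0.
  exact: row_orthogonal.
have sp1 q : \sum_p e p * (C p q0 * C p q) = (q0 == q)%:R / c q0 - 1.
  apply: (mulIf (residue_neq0 q0)).
  by rewrite mulrBl divfK ?residue_neq0// mul1r -col_orthogonal mulr_suml.
under eq_bigr => p _ do (under eq_bigr => q _ do rewrite split_term;
  rewrite -mulr_sumr big_split sumrB/= -!mulr_sumr !sq1 eqxx).
rewrite -mulr_sumr big_split sumrB/= exchange_big/=.
under [X in _ * (_ + X)]eq_bigr => q _ do rewrite -mulr_sumr sp1.
rewrite (bigD1 p0)//= eqxx big1 ?addr0; last first.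
  by move=> p; rewrite eq_sym => /negPf->; rewrite mul0r mulr0.
rewrite -mulr_suml.
under [X in _ - X * _]eq_bigr do rewrite expr2.
rewrite sp1 eqxx.
rewrite [X in _ + X](_ : _ = C p0 q0 ^+ 2 - (e p0)^-1); last first.
  under eq_bigr do rewrite mulrBr mulr1.
  rewrite sumrB (bigD1 q0)//= eqxx big1 ?addr0; last first.
    by move=> q; rewrite eq_sym => /negPf->; rewrite mul0r mulr0.
  congr (_ - _); first by rewrite mulrC mul1r mulKf ?residue_neq0.
  by under eq_bigr do rewrite expr2; rewrite sq1 eqxx mul1r.
rewrite !mulr1n; have := dual_weight_neq0 p0; have := residue_neq0 q0.
by move: (C p0 q0) (c q0) (e p0) => a b d d0 b0; field; rewrite b0 d0.
Qed.

(** The second derivative of the logarithm of a Cauchy determinant in the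
    direction [(u, t)], computed in two ways.  Differentiating the product
    formula gives the sums of [G ^+ 2] and of the squared divided differences
    inside each row; the formula tr (M^-1 M'') - tr ((M^-1 M')^2) gives the
    other two sums, [S] being M^-1 M' up to conjugation by a diagonal matrix.
    The direct proof below polarises the product (u_p' - t_q) (u_p - t_q')
    into four squares; each square involves two of the four indices, and the
    other two are summed out first. *)
Lemma trace_identity (u : 'I_k -> F) (t : 'I_k.+1 -> F) :
  let G p q := (u p - t q) * C p q in
  let S p p' := \sum_q c q * (C p q * C p' q * G p' q) in
  2 * (\sum_p \sum_p' e p * e p' * (S p p' * S p' p)) =
  4 * (\sum_p \sum_q e p * c q * C p q ^+ 2 * G p q ^+ 2)
  - 2 * (\sum_p \sum_q G p q ^+ 2)
  + \sum_p \sum_p' (u p - u p') ^+ 2 / (x p - x p') ^+ 2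
  + \sum_q \sum_q' (t q - t q') ^+ 2 / (w q - w q') ^+ 2.
Proof.
move=> G S.
pose K p p' q q' := e p * e p' * (c q * (C p q * C p' q ^+ 2)) *
                    (c q' * (C p' q' * C p q' ^+ 2)).
pose T1 := \sum_p \sum_p' \sum_q \sum_q' K p p' q q' * (u p' - t q') ^+ 2.
pose T2 := \sum_p \sum_p' \sum_q \sum_q' K p p' q q' * (u p - t q) ^+ 2.
pose T3 := \sum_p \sum_p' \sum_q \sum_q' K p p' q q' * (u p - u p') ^+ 2.
pose T4 := \sum_p \sum_p' \sum_q \sum_q' K p p' q q' * (t q - t q') ^+ 2.
have -> : 2 * (\sum_p \sum_p' e p * e p' * (S p p' * S p' p)) =
          T1 + T2 - T3 - T4.
  rewrite mulr_sumr -big_split -!sumrB; apply: eq_bigr => p _ /=.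
  rewrite mulr_sumr -big_split -!sumrB; apply: eq_bigr => p' _ /=.
  rewrite /S big_distrlr/= mulr_sumr mulr_sumr -big_split -!sumrB.
  apply: eq_bigr => q _ /=.
  rewrite mulr_sumr mulr_sumr -big_split -!sumrB; apply: eq_bigr => q' _ /=.
  rewrite /K /G; move: (C p q) (C p' q) (C p q') (C p' q') => a b d f; ring.
(* Up to renaming of indices, T1 and T2 coincide: both leave a free pair (p, q)
   and the double sum evaluated by sum_quartic. *)
pose quartic p0 q0 := (u p0 - t q0) ^+ 2 * (e p0 * c q0 * C p0 q0) *
  \sum_p \sum_q e p * c q * (C p q * C p0 q ^+ 2 * C p q0 ^+ 2).
have quarticE p q : quartic p q =
    2 * (e p * c q * C p q ^+ 2 * G p q ^+ 2) - G p q ^+ 2.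
  rewrite /quartic sum_quartic /G.
  have := dual_weight_neq0 p; have := residue_neq0 q.
  by move: (C p q) (c q) (e p) => a b d d0 b0; field; rewrite b0 d0.
have -> : T1 = \sum_p \sum_q quartic p q.
  rewrite /T1 exchange_big; apply: eq_bigr => p' _ /=.
  under eq_bigr do rewrite exchange_big/=.
  rewrite exchange_big/=; apply: eq_bigr => q' _; rewrite /quartic.
  rewrite mulr_sumr; apply: eq_bigr => p _; rewrite mulr_sumr.
  apply: eq_bigr => q _; rewrite /K.
  by move: (C p q) (C p' q) (C p q') (C p' q') => a b d f; ring.
have -> : T2 = \sum_p \sum_q quartic p q.
  rewrite /T2; apply: eq_bigr => p _ /=.
  rewrite exchange_big/=; apply: eq_bigr => q _; rewrite /quartic.
  rewrite mulr_sumr; apply: eq_bigr => p' _; rewrite mulr_sumr.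
  apply: eq_bigr => q' _; rewrite /K.
  by move: (C p q) (C p' q) (C p q') (C p' q') => a b d f; ring.
have -> : T3 = - \sum_p \sum_p' (u p - u p') ^+ 2 / (x p - x p') ^+ 2.
  rewrite -sumrN; apply: eq_bigr => p _; rewrite -sumrN; apply: eq_bigr => p' _.
  have [<-|pp] := eqVneq p p'.
    rewrite subrr expr0n/= mul0r oppr0 big1// => q _.
    by rewrite big1// => q' _; rewrite mulr0.
  transitivity ((u p - u p') ^+ 2 * (e p * e p' *
     ((\sum_q c q * (C p q * C p' q ^+ 2)) *
      (\sum_q c q * (C p' q * C p q ^+ 2))))).
    rewrite big_distrlr/= !mulr_sumr; apply: eq_bigr => q _.
    by rewrite !mulr_sumr; apply: eq_bigr => q' _; rewrite /K mulrC !mulrA.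
  rewrite !sum_row_cubic// 1?eq_sym//.
  have x0 : x p - x p' != 0.
    by rewrite subr_eq0; apply: contra pp => /eqP/x_inj->.
  rewrite -(opprB (x p)).
  have := dual_weight_neq0 p; have := dual_weight_neq0 p'.
  move: (e p) (e p') (x p - x p') x0 => a b d d0 b0 a0.
  by field; rewrite ?oppr_eq0 a0 b0 d0.
have -> : T4 = - \sum_q \sum_q' (t q - t q') ^+ 2 / (w q - w q') ^+ 2.
  transitivity (\sum_q \sum_q' \sum_p \sum_p' K p p' q q' * (t q - t q') ^+ 2).
    rewrite /T4; under eq_bigr do rewrite exchange_big/=.
    rewrite exchange_big/=; apply: eq_bigr => q _.
    under eq_bigr do rewrite exchange_big/=.
    by rewrite exchange_big.
  rewrite -sumrN; apply: eq_bigr => q _; rewrite -sumrN; apply: eq_bigr => q' _.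
  have [<-|qq] := eqVneq q q'.
    rewrite subrr expr0n/= mul0r oppr0 big1// => p _.
    by rewrite big1// => p' _; rewrite mulr0.
  transitivity ((t q - t q') ^+ 2 * (c q * c q' *
     ((\sum_p e p * (C p q * C p q' ^+ 2)) *
      (\sum_p e p * (C p q' * C p q ^+ 2))))).
    rewrite big_distrlr/= !mulr_sumr; apply: eq_bigr => p _.
    rewrite !mulr_sumr; apply: eq_bigr => p' _; rewrite /K.
    by move: (C p q) (C p' q) (C p q') (C p' q') => a b d f; ring.
  rewrite !sum_col_cubic// 1?eq_sym//.
  have w0 : w q - w q' != 0.
    by rewrite subr_eq0; apply: contra qq => /eqP/w_inj->.
  rewrite -(opprB (w q)).
  have := residue_neq0 q; have := residue_neq0 q'.
  move: (c q) (c q') (w q - w q') w0 => a b d d0 b0 a0.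
  by field; rewrite ?oppr_eq0 a0 b0 d0.
under eq_bigr do under eq_bigr do rewrite quarticE.
under eq_bigr do rewrite sumrB -mulr_sumr.
rewrite sumrB -mulr_sumr.
set X1 := \sum_p \sum_q _; set X2 := \sum_p \sum_q _.
set X3 := \sum_p _; set X4 := \sum_q _; ring.
Qed.

End CauchyOrthogonality.

(** * Log-convexity of the Cauchy determinant of two interlacing rows *)

Section Interlacing.
Variables (R : realFieldType) (k : nat) (x : 'I_k -> R) (w : 'I_k.+1 -> R).
Hypothesis x_lt_w : forall (p : 'I_k) (q : 'I_k.+1), (q <= p)%N -> x p < w q.
Hypothesis w_lt_x : forall (p : 'I_k) (q : 'I_k.+1), (p < q)%N -> w q < x p.

Lemma interlacing_neq p q : x p != w q.
Proof.
by case: (leqP q p) => [/x_lt_w/lt_eqF->|/w_lt_x/gt_eqF->].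
Qed.

Lemma interlacing_w_lt (i j : 'I_k.+1) : (i < j)%N -> w j < w i.
Proof.
move=> ij; have ik : (i < k)%N by apply: leq_trans ij _; rewrite -ltnS.
by apply: (@lt_trans _ _ (x (Ordinal ik))); [exact: w_lt_x|exact: x_lt_w].
Qed.

Lemma interlacing_w_inj : injective w.
Proof.
move=> i j wij; apply/val_inj/eqP; rewrite eqn_leq.
by apply/andP; split; rewrite leqNgt; apply/negP => /interlacing_w_lt;
  rewrite wij ltxx.
Qed.

Lemma interlacing_x_inj : injective x.
Proof.
have x_lt (i j : 'I_k) : (i < j)%N -> x j < x i.
  move=> ij; apply: (@lt_trans _ _ (w (widen_ord (leqnSn k) j))).
    exact: x_lt_w.
  exact: w_lt_x.
move=> i j xij; apply/val_inj/eqP; rewrite eqn_leq.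
by apply/andP; split; rewrite leqNgt; apply/negP => /x_lt; rewrite xij ltxx.
Qed.

Lemma residue_gt0 q : 0 < residue x w q.
Proof.
apply: prodr_gt0 => p _; case: (leqP q p) => qp.
  apply: divr_gt0; rewrite subr_gt0; first exact: x_lt_w.
  by apply: interlacing_w_lt; rewrite /= /bump qp.
rewrite -mulrNN -invrN !opprB.
apply: divr_gt0; rewrite subr_gt0; first exact: w_lt_x.
by apply: interlacing_w_lt; rewrite /= /bump (leqNgt q) qp.
Qed.

Let c := residue x w.
Let C p q := (x p - w q)^-1.
Definition dual_residue p := (\sum_q c q * C p q ^+ 2)^-1.
Let e := dual_residue.

Let C2_gt0 p q : 0 < C p q ^+ 2.
Proof. by rewrite exprn_even_gt0//= /C invr_eq0 subr_eq0 interlacing_neq. Qed.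

Let sum_gt0 p : 0 < \sum_q c q * C p q ^+ 2.
Proof.
rewrite big_ord_recl; apply: ltr_pwDl; first by rewrite mulr_gt0 ?residue_gt0.
by apply: sumr_ge0 => q _; rewrite mulr_ge0 ?ltW ?residue_gt0.
Qed.

Let e_gt0 p : 0 < e p. Proof. by rewrite /e /dual_residue invr_gt0. Qed.

Let eE p : e p * (\sum_q c q * C p q ^+ 2) = 1.
Proof. by rewrite /e /dual_residue mulVf// gt_eqF. Qed.

(** Bessel's inequality for the orthonormal rows of the weighted Cauchy matrix;
    the defect is the squared coefficient on the remaining row
    [sqrt (c q)]. *)
Lemma cauchy_bessel (g : 'I_k.+1 -> R) :
  \sum_p e p * (\sum_q c q * C p q * g q) ^+ 2 <= \sum_q c q * g q ^+ 2.
Proof.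
suff -> : \sum_p e p * (\sum_q c q * C p q * g q) ^+ 2 =
          \sum_q c q * g q ^+ 2 - (\sum_q c q * g q) ^+ 2.
  by rewrite gerBl sqr_ge0.
transitivity (\sum_q \sum_q' c q' * g q * g q' *
    \sum_p e p * (C p q * C p q') * c q).
  under eq_bigr do rewrite expr2 big_distrlr/= mulr_sumr.
  rewrite exchange_big; apply: eq_bigr => q _ /=.
  under eq_bigr do rewrite mulr_sumr.
  rewrite exchange_big; apply: eq_bigr => q' _ /=.
  rewrite mulr_sumr; apply: eq_bigr => p _.
  by move: (C p q) (C p q') => a b; ring.
rewrite expr2 big_distrlr -sumrB; apply: eq_bigr => q _ /=.
under eq_bigr do rewrite (col_orthogonal interlacing_x_inj
  interlacing_w_inj interlacing_neq eE) mulrBr.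
rewrite sumrB; congr (_ - _); last by apply: eq_bigr => q' _; rewrite -/c; ring.
rewrite (bigD1 q)//= eqxx big1 ?addr0 => [|q' /negPf qq].
  by rewrite mulr1n; ring.
by rewrite eq_sym qq mulr0.
Qed.

(** By [trace_identity] it suffices that tr S^2 <= ||S||^2 <= ||G||^2 in
    weighted Frobenius norms: the first bound is Cauchy-Schwarz for [S] and its
    transpose, the second is [cauchy_bessel] row by row.  This leaves one full
    copy of the weighted norm of [G] as the strictly positive defect [rho]. *)
Lemma interlacing_inequality : exists rho : 'I_k -> 'I_k.+1 -> R,
  (forall p q, 0 < rho p q) /\
  forall (u : 'I_k -> R) (t : 'I_k.+1 -> R),
    \sum_p \sum_p' (u p - u p') ^+ 2 / (x p - x p') ^+ 2
    + \sum_q \sum_q' (t q - t q') ^+ 2 / (w q - w q') ^+ 2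
    + \sum_p \sum_q rho p q * (u p - t q) ^+ 2
  <= 2 * \sum_p \sum_q (u p - t q) ^+ 2 / (x p - w q) ^+ 2.
Proof.
exists (fun p q => 2 * (e p * c q * C p q ^+ 2 * C p q ^+ 2)); split.
  move=> p q /=; have cq : 0 < c q := residue_gt0 q.
  by do ![apply: mulr_gt0 => //].
move=> u t.
have := trace_identity interlacing_x_inj interlacing_w_inj interlacing_neq
  eE u t.
rewrite /= -/C.
pose G p q := (u p - t q) * C p q.
pose S p p' := \sum_q c q * (C p q * C p' q * G p' q).
pose P := \sum_p \sum_q e p * c q * C p q ^+ 2 * G p q ^+ 2.
pose T := \sum_p \sum_p' e p * e p' * (S p p' * S p' p).
rewrite -/T -/P.
have TP : T <= P.
  pose V := \sum_p \sum_p' e p * e p' * S p p' ^+ 2.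
  have TV : T <= V.
    have V' : V = \sum_p \sum_p' e p * e p' * S p' p ^+ 2.
      rewrite /V exchange_big; apply: eq_bigr => p _; apply: eq_bigr => p' _.
      by rewrite (mulrC (e p)).
    have : T + T <= V + V.
      rewrite {2}V' /T /V -!big_split; apply: ler_sum => p _ /=.
      rewrite -!big_split; apply: ler_sum => p' _ /=.
      rewrite -!mulrDr; apply: ler_wpM2l; first by rewrite mulr_ge0// ltW.
      have := sqr_ge0 (S p p' - S p' p); nra.
    by lra.
  apply: (le_trans TV); rewrite /V exchange_big; apply: ler_sum => p' _ /=.
  have := cauchy_bessel (fun q => C p' q * G p' q).
  move=> /(ler_wpM2l (ltW (e_gt0 p'))); rewrite !mulr_sumr => h.
  apply: (le_trans (le_trans _ h)).
    rewrite le_eqVlt; apply/orP; left; apply/eqP; apply: eq_bigr => p _.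
    rewrite -mulrA mulrCA; congr (_ * (_ * _ ^+ 2)).
    by apply: eq_bigr => q _; rewrite !mulrA.
  rewrite le_eqVlt; apply/orP; left; apply/eqP; apply: eq_bigr => q _.
  by rewrite exprMn !mulrA.
have -> : \sum_p \sum_q (u p - t q) ^+ 2 / (x p - w q) ^+ 2 =
    \sum_p \sum_q ((u p - t q) * C p q) ^+ 2.
  apply: eq_bigr => p _; apply: eq_bigr => q _.
  by rewrite exprMn /C exprVn.
have -> : \sum_p \sum_q 2 * (e p * c q * C p q ^+ 2 * C p q ^+ 2) *
    (u p - t q) ^+ 2 = 2 * P.
  rewrite mulr_sumr; apply: eq_bigr => p _; rewrite mulr_sumr.
  apply: eq_bigr => q _; rewrite /G; move: (C p q) => b; ring.
move: TP; set X1 := \sum_p \sum_p' _ / _; set X2 := \sum_q \sum_q' _.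
by set X3 := \sum_p \sum_q _; lra.
Qed.

End Interlacing.

Lemma sum_sym_offdiag (R : pzRingType) (F : nat -> nat -> R) n :
  (forall i j, F i j = F j i) -> (forall i, F i i = 0) ->
  \sum_(1 <= i < n.+1) \sum_(1 <= j < n.+1) F i j =
  2 * \sum_(1 <= i < n.+1) \sum_(i.+1 <= j < n.+1) F i j.
Proof.
move=> Fsym F0; elim: n => [|n IH]; first by rewrite !big_geq ?mulr0.
rewrite [in LHS]big_nat_recr//= [in RHS]big_nat_recr//= (@big_geq _ _ _ n.+2)//.
rewrite addr0 [\sum_(1 <= j < n.+2) F n.+1 j]big_nat_recr//= F0 addr0.
under eq_bigr do rewrite big_nat_recr//=.
rewrite big_split/= IH.
rewrite [in RHS](eq_big_nat _ _ (F2 := fun i =>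
  \sum_(i.+1 <= j < n.+1) F i j + F i n.+1)); last first.
  by move=> i /andP[_ ?]; rewrite big_nat_recr.
rewrite big_split/= mulrDr -addrA; congr (_ + _).
rewrite mulr_natl mulr2n; congr (_ + _).
by apply: eq_bigr.
Qed.

(** * Telescoping over the rows of a triangular array *)

Section Triangular.
Variable R : realFieldType.
Implicit Types y v : nat -> nat -> R.

Definition interlaced y k := forall i, (1 <= i <= k)%N ->
  y k.+1 i > y k i /\ y k i > y k.+1 i.+1.

(** The sum runs over ordered pairs, hence counts each unordered pair twice;
    the diagonal terms vanish because their numerators do. *)
Definition row_energy y v k : R :=
  \sum_(1 <= i < k.+1) \sum_(1 <= j < k.+1)
    (v k i - v k j) ^+ 2 / (y k i - y k j) ^+ 2.

Definition cross_energy y v k : R :=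
  \sum_(1 <= p < k.+1) \sum_(1 <= q < k.+2)
    (v k p - v k.+1 q) ^+ 2 / (y k p - y k.+1 q) ^+ 2.

Lemma interlaced_upper_ge y k i d : interlaced y k ->
  (1 <= i)%N -> (i + d <= k.+1)%N -> y k.+1 (i + d)%N <= y k.+1 i.
Proof.
move=> yk i1; elim: d => [|d IH] idk; first by rewrite addn0.
have [|h1 h2] := yk (i + d)%N; first lia.
rewrite addnS; apply: le_trans (IH _); last lia.
exact: ltW (lt_trans h2 h1).
Qed.

Lemma interlaced_lt y k p q : interlaced y k ->
  (1 <= q)%N -> (q <= p <= k)%N -> y k p < y k.+1 q.
Proof.
move=> yk q1 qpk; have [|h _] := yk p; first lia.
apply: lt_le_trans h _; rewrite (_ : p = q + (p - q))%N; last lia.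
by apply: interlaced_upper_ge => //; lia.
Qed.

Lemma interlaced_gt y k p q : interlaced y k ->
  (1 <= p)%N -> (p < q <= k.+1)%N -> y k.+1 q < y k p.
Proof.
move=> yk p1 pqk; have [|_ h] := yk p; first lia.
apply: le_lt_trans h; rewrite (_ : q = p.+1 + (q - p.+1))%N; last lia.
by apply: interlaced_upper_ge => //; lia.
Qed.

Lemma interlaced_cross_neq y k p q : interlaced y k ->
  (1 <= p <= k)%N -> (1 <= q <= k.+1)%N -> y k p - y k.+1 q != 0.
Proof.
move=> yk pk qk; rewrite subr_eq0; case: (leqP q p) => pq.
  by rewrite lt_eqF// interlaced_lt//; lia.
by rewrite gt_eqF// interlaced_gt//; lia.
Qed.

Lemma interlaced_row_lt y k i j : interlaced y k ->
  (1 <= i)%N -> (i < j <= k)%N -> y k j < y k i.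
Proof.
move=> yk i1 ijk; apply: (@lt_trans _ _ (y k.+1 j)).
  by apply: interlaced_lt => //; lia.
by apply: interlaced_gt => //; lia.
Qed.

(** [interlacing_inequality] for two adjacent rows of an array, together with
    its equality case: the positivity of [rho] forces all [v k p] and
    [v k.+1 q] to agree. *)
Lemma row_cross_energy y v k : interlaced y k ->
  row_energy y v k + row_energy y v k.+1 <= 2 * cross_energy y v k /\
  (row_energy y v k + row_energy y v k.+1 = 2 * cross_energy y v k ->
   forall p q, (1 <= p <= k)%N -> (1 <= q <= k.+1)%N -> v k p = v k.+1 q).
Proof.
move=> yk.
have xw (p : 'I_k) (q : 'I_k.+1) : (q <= p)%N -> y k p.+1 < y k.+1 q.+1.
  by move=> qp; apply: interlaced_lt => //; have := ltn_ord p; lia.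
have wx (p : 'I_k) (q : 'I_k.+1) : (p < q)%N -> y k.+1 q.+1 < y k p.+1.
  by move=> pq; apply: interlaced_gt => //; have := ltn_ord q; lia.
have [rho [rho0 /(_ (fun p => v k p.+1) (fun q => v k.+1 q.+1))]] :=
  interlacing_inequality xw wx.
have rowE n : row_energy y v n = \sum_(i < n) \sum_(j < n)
    (v n i.+1 - v n j.+1) ^+ 2 / (y n i.+1 - y n j.+1) ^+ 2.
  rewrite /row_energy big_add1 big_mkord; apply: eq_bigr => i _.
  by rewrite big_add1 big_mkord.
have crossE : cross_energy y v k = \sum_(p < k) \sum_(q < k.+1)
    (v k p.+1 - v k.+1 q.+1) ^+ 2 / (y k p.+1 - y k.+1 q.+1) ^+ 2.
  rewrite /cross_energy big_add1 big_mkord; apply: eq_bigr => i _.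
  by rewrite big_add1 big_mkord.
rewrite -!rowE -crossE; set E := \sum_p _ => ineq.
have term0 p q : 0 <= rho p q * (v k p.+1 - v k.+1 q.+1) ^+ 2.
  by rewrite mulr_ge0 ?sqr_ge0 ?ltW.
have row0 p : 0 <= \sum_q rho p q * (v k p.+1 - v k.+1 q.+1) ^+ 2.
  by apply: sumr_ge0 => q _.
have E0 : 0 <= E by apply: sumr_ge0.
split=> [|eqE]; first by lra.
have {}E0 : E = 0 by lra.
case=> // p [//|q] /= pk qk.
have /(_ (Ordinal pk) isT) Ep := psumr_eq0P (fun i _ => row0 i) E0.
have /(_ (Ordinal qk) isT) /eqP := psumr_eq0P (fun i _ => term0 _ i) Ep.
by rewrite mulf_eq0 gt_eqF//= sqrf_eq0 subr_eq0 => /eqP.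
Qed.

Definition triangular_form y v N : R :=
  \sum_(1 <= k < N)
    (\sum_(1 <= i < k.+1) \sum_(i.+1 <= j < k.+1)
       (v k i - v k j) ^+ 2 / (2 * (y k i - y k j) ^+ 2)
     - \sum_(1 <= p < k.+1) \sum_(1 <= q < k.+2)
         (v k p - v k.+1 q) ^+ 2 / (4 * (y k p - y k.+1 q) ^+ 2)).

Lemma triangular_formE y v N : triangular_form y v N =
  \sum_(1 <= k < N) (row_energy y v k - cross_energy y v k) / 4.
Proof.
apply: eq_bigr => k _; rewrite mulrBl; congr (_ - _).
  rewrite /row_energy (@sum_sym_offdiag _ (fun i j =>
     (v k i - v k j) ^+ 2 / (y k i - y k j) ^+ 2)); last first.
  - by move=> i; rewrite subrr expr0n/= mul0r.
  - by move=> i j; rewrite -sqrrN opprB -(sqrrN (y k i - _)) opprB.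
  rewrite mulr_sumr mulr_suml; apply: eq_bigr => i _.
  rewrite mulr_sumr mulr_suml; apply: eq_bigr => j _.
  by rewrite invfM; move: ((y k i - y k j) ^- 2) => b; field.
rewrite /cross_energy mulr_suml; apply: eq_bigr => p _.
rewrite mulr_suml; apply: eq_bigr => q _.
by rewrite invfM mulrCA mulrC.
Qed.

(** Bounding each cross energy from below by the mean of the two adjacent row
    energies makes the form telescope to (row 1 - row N) / 8 = 0, the first
    row having a single entry and the last one vanishing.  If the form were
    nonnegative, all these bounds would be equalities, so every row of [v]
    would be constant and equal to the next one; descending from row [N],
    [v] would vanish. *)
Lemma triangular_form_lt0 y v N :
  (forall k, (1 <= k < N)%N -> interlaced y k) ->
  (forall i, (1 <= i <= N)%N -> v N i = 0) ->
  (exists k i, (1 <= i <= k)%N /\ (k <= N)%N /\ v k i != 0) ->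
  triangular_form y v N < 0.
Proof.
move=> yint vN [k0 [i0 [ik0 [kN vk0]]]]; rewrite ltNge; apply/negP.
have N1 : (1 <= N)%N by lia.
pose d k := 2 * cross_energy y v k - row_energy y v k - row_energy y v k.+1.
have row1 : row_energy y v 1 = 0.
  by rewrite /row_energy !big_nat1 subrr expr0n/= mul0r.
have rowN : row_energy y v N = 0.
  rewrite /row_energy big_nat big1// => i iN.
  rewrite big_nat big1// => j jN.
  by rewrite !vN ?subrr ?expr0n ?mul0r//; lia.
have -> : triangular_form y v N = - (\sum_(1 <= k < N) d k) / 8.
  rewrite triangular_formE.
  have tel : \sum_(1 <= k < N) (row_energy y v k.+1 - row_energy y v k) = 0.
    by rewrite telescope_sumr// rowN row1 subrr.
  rewrite -[LHS]addr0 -[X in _ + X](mulr0 8^-1) -[X in _ * X]tel.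
  rewrite mulr_sumr -big_split -sumrN mulr_suml.
  by apply: eq_bigr => k _ /=; rewrite /d; lra.
rewrite pmulr_lge0 ?invr_gt0// oppr_ge0 => le0.
have d0 k : (1 <= k < N)%N -> 0 <= d k.
  by move=> /yint/(row_cross_energy v)[]; rewrite /d; lra.
have deq k : (1 <= k < N)%N -> d k = 0.
  move=> kN'; move: le0; rewrite big_add1 big_mkord => le0.
  have d0' (i : 'I_N.-1) : 0 <= d i.+1 by apply: d0; have := ltn_ord i; lia.
  have sum0 : \sum_(i < N.-1) d i.+1 = 0.
    by apply/eqP; rewrite eq_le le0 sumr_ge0.
  have kN1 : (k.-1 < N.-1)%N by lia.
  have /(_ (Ordinal kN1) isT) /= := psumr_eq0P (fun i _ => d0' i) sum0.
  by rewrite prednK//; lia.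
have v0 m k i : (k + m)%N = N -> (1 <= i <= k)%N -> v k i = 0.
  elim: m k i => [|m IH] k i kmN ik; first by
    move: kmN ik; rewrite addn0 => -> ik; apply: vN; lia.
  have kN' : (1 <= k < N)%N by lia.
  have [_ /(_ _ i 1%N ik isT) ->] := row_cross_energy v (yint _ kN').
    by apply: IH; lia.
  by have := deq _ kN'; rewrite /d; lra.
by move: vk0; rewrite (v0 (N - k0)%N)//; [rewrite eqxx|lia].
Qed.
End Triangular.

(** * Second derivatives on the unit interval *)

Section SecondDerivative.
Variable R : realType.
Implicit Types f g : R -> R.

(** Derivatives are two-sided also at the end points of [0, 1]: a segment
    inside an open polytope extends slightly beyond its ends.  Packaging both
    derivatives makes the predicate stable under finite sums. *)
Definition second_deriv01 f (f2 : R -> R) := exists f1 : R -> R,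
  forall s : R, 0 <= s <= 1 ->
    is_derive s 1 f (f1 s) /\ is_derive s 1 f1 (f2 s).

Lemma second_deriv01_eq f g f2 g2 : f =1 g -> f2 =1 g2 ->
  second_deriv01 g g2 -> second_deriv01 f f2.
Proof. by move=> /funext-> /funext->. Qed.

Lemma second_deriv01_cst (b : R) : second_deriv01 (fun=> b) (fun=> 0).
Proof.
by exists (fun=> 0) => s _; split; exact: is_derive_cst.
Qed.

Lemma second_deriv01D f g f2 g2 : second_deriv01 f f2 -> second_deriv01 g g2 ->
  second_deriv01 (fun s => f s + g s) (fun s => f2 s + g2 s).
Proof.
move=> [f1 hf] [g1 hg]; exists (fun s => f1 s + g1 s) => s s01.
have [hf1 hf2] := hf s s01; have [hg1 hg2] := hg s s01.
by split; exact: is_deriveD.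
Qed.

Lemma second_deriv01Z f f2 (b : R) : second_deriv01 f f2 ->
  second_deriv01 (fun s => b * f s) (fun s => b * f2 s).
Proof.
move=> [f1 hf]; exists (fun s => b * f1 s) => s s01.
have [hf1 hf2] := hf s s01.
by split; exact: is_deriveZ.
Qed.

Lemma second_deriv01B f g f2 g2 : second_deriv01 f f2 -> second_deriv01 g g2 ->
  second_deriv01 (fun s => f s - g s) (fun s => f2 s - g2 s).
Proof.
move=> [f1 hf] [g1 hg]; exists (fun s => f1 s - g1 s) => s s01.
have [hf1 hf2] := hf s s01; have [hg1 hg2] := hg s s01.
by split; exact: is_deriveB.
Qed.

Lemma second_deriv01_sum m n (F F2 : nat -> R -> R) :
  (forall i, (m <= i < n)%N -> second_deriv01 (F i) (F2 i)) ->
  second_deriv01 (fun s => \sum_(m <= i < n) F i s)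
                 (fun s => \sum_(m <= i < n) F2 i s).
Proof.
elim: n => [|n IH] hF.
  have -> : (fun s => \sum_(m <= i < 0) F i s) = fun=> 0.
    by apply/funext => s; rewrite big_geq.
  have -> : (fun s => \sum_(m <= i < 0) F2 i s) = fun=> 0.
    by apply/funext => s; rewrite big_geq.
  exact: second_deriv01_cst.
case: (leqP m n) => mn; last first.
  have -> : (fun s => \sum_(m <= i < n.+1) F i s) = fun=> 0.
    by apply/funext => s; rewrite big_geq.
  have -> : (fun s => \sum_(m <= i < n.+1) F2 i s) = fun=> 0.
    by apply/funext => s; rewrite big_geq.
  exact: second_deriv01_cst.
under eq_fun do rewrite big_nat_recr//=.
under [X in second_deriv01 _ X]eq_fun do rewrite big_nat_recr//=.
apply: second_deriv01D; last by apply: hF; rewrite mn ltnSn.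
by apply: IH => i /andP[mi i_n]; apply: hF; rewrite mi ltnS ltnW.
Qed.

Lemma is_derive_affine (b d s : R) : is_derive s 1 (fun r => b + r * d) d.
Proof.
have -> : (fun r : R => b + r * d) = cst b + d \*: id.
  by apply/funext => r; rewrite /= /GRing.scale/= mulrC.
apply: is_derive_eq.
by rewrite add0r /GRing.scale/= mulr1.
Qed.

Lemma second_deriv01_affine (b d : R) :
  second_deriv01 (fun s => b + s * d) (fun=> 0).
Proof.
exists (fun=> d) => s _; split; first exact: is_derive_affine.
exact: is_derive_cst.
Qed.

Lemma is_derive_affineV (b d s : R) : b + s * d != 0 ->
  is_derive s 1 (fun r => d / (b + r * d)) (- d ^+ 2 / (b + s * d) ^+ 2).
Proof.
move=> sd0.
have h := is_deriveZ d (@is_deriveV _ (fun r => b + r * d) s d 1 sd0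
  (is_derive_affine b d s)).
apply: is_derive_eq h _.
by rewrite /GRing.scale/=; field.
Qed.

Lemma is_derive_ln_norm_affine (b d s : R) : b + s * d != 0 ->
  is_derive s 1 (fun r => ln `|b + r * d|) (d / (b + s * d)).
Proof.
move=> sd0.
(* Passing to the square removes the case distinction on the sign, and also
   holds at 0 where ln is 0 by convention. *)
have ln_norm x : ln `|x| = 2^-1 * ln (x ^+ 2) :> R.
  have [->|x0] := eqVneq x 0; first by rewrite normr0 expr0n/= ln0// mulr0.
  rewrite -real_normK ?num_real// lnXn ?normr_gt0//.
  by rewrite -[ln _ *+ 2]mulr_natl mulKf.
under eq_fun do rewrite ln_norm.
have sq_gt0 : 0 < (b + s * d) ^+ 2 by rewrite exprn_even_gt0.
have h1 := is_deriveX 2 (is_derive_affine b d s).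
have h := is_deriveZ 2^-1
  (@is_derive1_comp _ (@ln R) ((fun r => b + r * d) ^+ 2) s _ _
  (is_derive1_ln sq_gt0) h1).
apply: is_derive_eq h _.
by rewrite /GRing.scale/=; field.
Qed.

Lemma second_deriv01_ln_norm (b d : R) :
  (forall s : R, 0 <= s <= 1 -> b + s * d != 0) ->
  second_deriv01 (fun s => ln `|b + s * d|)
                 (fun s => - d ^+ 2 / (b + s * d) ^+ 2).
Proof.
move=> h; exists (fun s => d / (b + s * d)) => s /h sd0.
by split; [exact: is_derive_ln_norm_affine|exact: is_derive_affineV].
Qed.

Lemma second_deriv01_ln (b d : R) :
  (forall s : R, 0 <= s <= 1 -> 0 < b + s * d) ->
  second_deriv01 (fun s => ln (b + s * d))
                 (fun s => - d ^+ 2 / (b + s * d) ^+ 2).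
Proof.
move=> h; exists (fun s => d / (b + s * d)) => s /h sd0; split; last first.
  by apply: is_derive_affineV; rewrite gt_eqF.
have h1 := @is_derive1_comp _ (@ln R) (fun r => b + r * d) s _ _
  (is_derive1_ln sd0) (is_derive_affine b d s).
by apply: is_derive_eq h1 _; rewrite mulrC.
Qed.

(** The mean value theorem on [0, t] and on [t, 1] turns the claim into a
    comparison of the first derivative at two ordered points, which a third
    use of it settles. *)
Lemma second_deriv01_strict_convex f f2 (t : R) : second_deriv01 f f2 ->
  (forall s : R, 0 <= s <= 1 -> 0 < f2 s) -> 0 < t < 1 ->
  f t < t * f 1 + (1 - t) * f 0.
Proof.
move=> [f1 hf] f2_gt0 /andP[t0 t1].
have mvt (g g1 : R -> R) a b : a < b -> 0 <= a -> b <= 1 ->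
    (forall s : R, 0 <= s <= 1 -> is_derive s 1 g (g1 s)) ->
    exists2 c, a < c < b & g b - g a = g1 c * (b - a).
  move=> ab a0 b1 hg.
  have hg' s : s \in `[a, b] -> is_derive s 1 g (g1 s).
    rewrite in_itv/= => /andP[? ?]; apply: hg.
    by rewrite (le_trans a0)// (le_trans _ b1).
  have dg s : s \in `]a, b[ -> is_derive s 1 g (g1 s).
    by move/subset_itv_oo_cc; exact: hg'.
  have cg : {within `[a, b], continuous g}.
    apply: derivable_within_continuous => s sab.
    exact: (@ex_derive _ _ _ _ _ _ _ (hg' s sab)).
  have [c + ->] := MVT ab dg cg.
  by rewrite in_itv/= => cab; exists c.
have [|c1 /andP[c10 c1t] e1] := mvt f f1 0 t t0 (lexx _) (ltW t1).
  by move=> s /hf[].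
have [|c2 /andP[c2t c21] e2] := mvt f f1 t 1 t1 (ltW t0) (lexx _).
  by move=> s /hf[].
have c12 : c1 < c2 by exact: lt_trans c1t c2t.
have [|c3 /andP[c31 c32] e3] := mvt f1 f2 c1 c2 c12 (ltW c10) (ltW c21).
  by move=> s /hf[].
have c3_gt0 : 0 < f2 c3 by apply: f2_gt0; apply/andP; split; lra.
have f1_lt : f1 c1 < f1 c2 by rewrite -subr_gt0 e3 mulr_gt0// subr_gt0.
have : 0 < t * (1 - t) * (f1 c2 - f1 c1) by rewrite !mulr_gt0// subr_gt0.
nra.
Qed.
End SecondDerivative.

(** * The Hamiltonian along a segment *)

Section Hamiltonian.
Variable R : realType.

Definition array_line (y d : nat -> nat -> R) (s : R) k i := y k i + s * d k i.

Definition hamiltonian (b : nat -> R) (N : nat) (y : nat -> nat -> R) : R :=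
  \sum_(1 <= k < N)
    (\sum_(1 <= i < k.+1) \sum_(i.+1 <= j < k.+1) ln (y k i - y k j)
     - 2^-1 * (\sum_(1 <= p < k.+1) \sum_(1 <= q < k.+2)
                 ln `|y k p - y k.+1 q|)
     - b k * (\sum_(1 <= i < k.+1) y k i)).

(** Every summand is the logarithm of an affine function of [s] or affine
    itself, so the second derivative is obtained term by term; interlacing
    keeps the arguments of the logarithms away from 0. *)
Lemma second_deriv01_hamiltonian b N (y d : nat -> nat -> R) :
  (forall s : R, 0 <= s <= 1 -> forall k, (1 <= k < N)%N ->
     interlaced (array_line y d s) k) ->
  second_deriv01 (fun s => hamiltonian b N (array_line y d s))
    (fun s => - 2 * triangular_form (array_line y d s) d N).
Proof.
move=> yint.
pose L := array_line y d.
have LB s k i k' i' :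
    L s k i - L s k' i' = (y k i - y k' i') + s * (d k i - d k' i').
  by rewrite /L /array_line; ring.
apply: (@second_deriv01_eq _ _ _ _ (fun s => \sum_(1 <= k < N)
    (\sum_(1 <= i < k.+1) \sum_(i.+1 <= j < k.+1)
        - (d k i - d k j) ^+ 2 / (L s k i - L s k j) ^+ 2
     - 2^-1 * (\sum_(1 <= p < k.+1) \sum_(1 <= q < k.+2)
        - (d k p - d k.+1 q) ^+ 2 / (L s k p - L s k.+1 q) ^+ 2)
     - b k * (\sum_(1 <= i < k.+1) 0)))) => //.
  move=> s; rewrite /triangular_form mulr_sumr; apply: eq_bigr => k _.
  rewrite big1_eq mulr0 subr0 mulrBr; congr (_ - _).
    rewrite mulr_sumr; apply: eq_bigr => i _.
    rewrite mulr_sumr; apply: eq_bigr => j _; rewrite invfM.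
    by move: ((_ - _) ^- 2) => c; field.
  rewrite !mulr_sumr; apply: eq_bigr => p _.
  rewrite !mulr_sumr; apply: eq_bigr => q _; rewrite invfM.
  by move: ((_ - _) ^- 2) => c; field.
apply: second_deriv01_sum => k kN.
apply: second_deriv01B; [apply: second_deriv01B|].
- apply: second_deriv01_sum => i ik; apply: second_deriv01_sum => j ijk.
  apply: second_deriv01_eq (second_deriv01_ln _) => [s|s|].
  + by rewrite LB.
  + by rewrite LB.
  + move=> s s01; rewrite -LB subr_gt0.
    by apply: (interlaced_row_lt (yint s s01 k kN)); lia.
- apply: second_deriv01Z.
  apply: second_deriv01_sum => i ik; apply: second_deriv01_sum => j ijk.
  apply: second_deriv01_eq (second_deriv01_ln_norm _) => [s|s|].
  + by rewrite LB.
  + by rewrite LB.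
  + move=> s s01; rewrite -LB.
    by apply: (interlaced_cross_neq (yint s s01 k kN)); lia.
- apply: second_deriv01Z; apply: second_deriv01_sum => i ik.
  exact: second_deriv01_affine.
Qed.

Lemma hamiltonian_strict_convex b N (y d : nat -> nat -> R) (t : R) :
  (forall s : R, 0 <= s <= 1 -> forall k, (1 <= k < N)%N ->
     interlaced (array_line y d s) k) ->
  (forall i, (1 <= i <= N)%N -> d N i = 0) ->
  (exists k i, (1 <= i <= k)%N /\ (k <= N)%N /\ d k i != 0) ->
  0 < t < 1 ->
  hamiltonian b N (array_line y d t) <
    t * hamiltonian b N (array_line y d 1)
    + (1 - t) * hamiltonian b N (array_line y d 0).
Proof.
move=> yint dN d0 t01.
apply: (second_deriv01_strict_convex (second_deriv01_hamiltonian b yint)) t01.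
move=> s s01; rewrite nmulr_rgt0; last by rewrite oppr_lt0.
by apply: triangular_form_lt0 => // k; exact: yint.
Qed.

Lemma entry_conv n (x y : tri_array R n) (t : {i01 R}) k i :
  entry (conv t (x : convex_lmodType (tri_array R n)) y) k i =
  t%:num * entry x k i + (1 - t%:num) * entry y k i.
Proof.
rewrite /entry; case: insub => [p|]; last by rewrite !mulr0 addr0.
by rewrite /conv/= !ffunE.
Qed.

Lemma gt_entry_conv N (z : N.-tuple R) (x y : tri_array R N.-1) (t : {i01 R})
    k i :
  gt_entry z (conv t (x : convex_lmodType (tri_array R N.-1)) y) k i =
  t%:num * gt_entry z x k i + (1 - t%:num) * gt_entry z y k i.
Proof.
rewrite /gt_entry; case: eqP => _; last exact: entry_conv.
by ring.
Qed.

Lemma gt_polytope_interlaced N (z : N.-tuple R) (Y : tri_array R N.-1) :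
  gt_polytope z Y <->
  forall k, (1 <= k < N)%N -> interlaced (gt_entry z Y) k.
Proof. by split => h k *; [move=> i; exact: h|exact: h]. Qed.

Lemma interlaced_conv (y y' : nat -> nat -> R) (t : R) k : 0 <= t <= 1 ->
  interlaced y k -> interlaced y' k ->
  interlaced (fun k i => t * y k i + (1 - t) * y' k i) k.
Proof.
move=> /andP[t0 t1] h h' i ik; have [a1 a2] := h i ik; have [b1 b2] := h' i ik.
have [->|tn0] := eqVneq t 0; first by rewrite !mul0r subr0 !mul1r !add0r.
have tgt0 : 0 < t by rewrite lt_neqAle eq_sym tn0.
by split; apply: ltr_leD; rewrite ?ltr_pM2l ?ler_wpM2l ?subr_ge0// ltW.
Qed.

Lemma tri_array_neq n (x y : tri_array R n) : x != y ->
  exists k i, (1 <= i <= k)%N /\ (k <= n)%N /\ entry x k i != entry y k i.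
Proof.
move=> xy; have [p xyp] : exists p, x p != y p.
  apply/existsP; apply: contraNT xy; rewrite negb_exists => /forallP h.
  by apply/eqP/ffunP => p; apply/eqP; rewrite -[_ == _]negbK h.
exists (val p).1, (val p).2; rewrite !entryE; split; first exact: (valP p).
by split=> //; rewrite -ltnS ltn_ord.
Qed.

End Hamiltonian.
Unset Implicit Arguments.

(** * Negative definiteness and strict convexity *)

Theorem proposition5p5 (R : realType) (N : nat) (z a : N.-tuple R)
    (hN : (2 <= N)%N)
    (hz : forall i, (1 <= i < N)%N -> z`_i.-1 > z`_i) :
  (forall Y : tri_array R N.-1, gt_polytope z Y ->
     forall v : tri_array R N,
       (forall i, (1 <= i <= N)%N -> entry v N i = 0) ->
       v != 0 -> gt_form z Y v < 0)
  /\ strictly_convex_function (gt_polytope z) (eff_hamiltonian a z).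
Proof.
split.
  move=> Y /gt_polytope_interlaced Yint v vN v0.
  apply: triangular_form_lt0 => //.
  have [k [i [ik [kN vki]]]] := tri_array_neq v0.
  exists k, i; split=> //; split=> //.
  move: vki; rewrite [X in _ != X](_ : _ = 0)//.
  by rewrite /entry; case: insub => // p; rewrite ffunE.
split.
  move=> x y t; rewrite !inE => /gt_polytope_interlaced hx.
  move=> /gt_polytope_interlaced hy.
  apply/gt_polytope_interlaced => k kN.
  have -> : gt_entry z (conv t x y) = fun k i =>
      t%:num * gt_entry z x k i + (1 - t%:num) * gt_entry z y k i.
    by apply/funext => k'; apply/funext => i; exact: gt_entry_conv.
  by apply: interlaced_conv; [|exact: hx|exact: hy]; rewrite ge0 le1.
move=> t t01 x y; rewrite !inE => /gt_polytope_interlaced hx.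
move=> /gt_polytope_interlaced hy xy.
(* Both arrays have top row z, so their difference d vanishes in row N. *)
pose d k i := gt_entry z x k i - gt_entry z y k i.
pose b k := (a`_k.-1 - a`_k) / 2.
have lineE s : array_line (gt_entry z y) d s = fun k i =>
    s * gt_entry z x k i + (1 - s) * gt_entry z y k i.
  by apply/funext => k; apply/funext => i; rewrite /array_line /d; ring.
have HE Y : eff_hamiltonian a z Y = hamiltonian b N (gt_entry z Y) by [].
rewrite convRE !HE.
have -> : gt_entry z (conv t x y) = array_line (gt_entry z y) d t%:num.
  by rewrite lineE; apply/funext => k; apply/funext => i; exact: gt_entry_conv.
have -> : gt_entry z x = array_line (gt_entry z y) d 1.
  by rewrite lineE; apply/funext => k; apply/funext => i; ring.
rewrite [X in _ + _ * hamiltonian b N X](_ : _ =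
  array_line (gt_entry z y) d 0); last first.
  by rewrite lineE; apply/funext => k; apply/funext => i; ring.
apply: hamiltonian_strict_convex => //.
- move=> s s01 k kN; rewrite lineE.
  by apply: interlaced_conv; [|exact: hx|exact: hy].
- by move=> i iN; rewrite /d /gt_entry eqxx subrr.
have [k [i [ik [kN xyki]]]] := tri_array_neq xy.
exists k, i; split=> //; split; first by apply: leq_trans kN _; exact: leq_pred.
have kN' : k != N by lia.
by rewrite /d /gt_entry (negPf kN') subr_eq0.
Qed.
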